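(* Let $n\ge m\ge 2$ and $r\ge 2$ be integers with $n\ge\frac{1}{r-1}(m+r)(m+2r-1)$. Then $\chi_{r=}^*(K_m\times K_n)=\chi_{r=}^*(K_{m(n)})$. Moreover, for every positive integer $k$, $K_m\times K_n$ is $r$-equitably $k$-colorable if and only if $K_{m(n)}$ is $r$-equitably $k$-colorable.
   Context: All graphs are finite, simple, undirected. For a positive integer $k$, a (proper) $k$-coloring of a graph $G$ is a map $f:V(G)\to\{1,\dots,k\}$ with $f(x)\ne f(y)$ whenever $xy\in E(G)$; its color classes are the sets $f^{-1}(i)$, $i=1,\dots,k$. For a positive integer $r$, an $r$-equitable $k$-coloring is a $k$-coloring in which any two color classes differ in size by at most $r$; $G$ is $r$-equitably $k$-colorable if it has one. The $r$-equitable chromatic threshold $\chi_{r=}^*(G)$ is the smallest integer $k$ such that $G$ is $r$-equitably $k'$-colorable for every $k'\ge k$. The Kronecker product $G\times H$ has vertex set $V(G)\times V(H)$, with $(x,y)(x',y')$ an edge iff $xx'\in E(G)$ and $yy'\in E(H)$. $K_{m(n)}$ denotes the complete $m$-partite graph with $n$ vertices in each part. *)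

(* Defs.v *)
From mathcomp Require Import all_boot all_order all_algebra.
From mathcomp Require boolp classical_sets.

Set Implicit Arguments.
Unset Strict Implicit.
Unset Printing Implicit Defensive.

Record sgraph := SGraph {
  vertex :> finType;
  edge : rel vertex;
  edge_sym : symmetric edge;
  edge_irr : irreflexive edge }.

Arguments edge {s}.

Section Coloring.
Variable G : sgraph.

(* The k colors are 0, ..., k - 1. *)
Definition coloring (k : nat) (f : G -> 'I_k) : Prop :=
  forall x y : G, edge x y -> f x <> f y.

Definition color_class (k : nat) (f : G -> 'I_k) (i : 'I_k) : {set G} :=
  [set x | f x == i].

Definition equitable_coloring (r k : nat) (f : G -> 'I_k) : Prop :=
  coloring f /\
  forall i j : 'I_k, #|color_class f i| <= #|color_class f j| + r.

Definition equitably_colorable (r k : nat) : Prop :=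
  exists f : G -> 'I_k, equitable_coloring r f.

Definition colorable_from (r k : nat) : Prop :=
  0 < k /\ forall k' : nat, k <= k' -> equitably_colorable r k'.

Definition is_equitable_threshold (r k : nat) : Prop :=
  colorable_from r k /\ forall l : nat, colorable_from r l -> k <= l.

(* The default value 0 is never used when r > 0: see equitable_thresholdP. *)
Definition equitable_threshold (r : nat) : nat :=
  classical_sets.xget 0 (is_equitable_threshold r).

Lemma colorable_from_card (r : nat) : 0 < r -> colorable_from r #|G|.+1.
Proof.
move=> r_gt0; split=> // k' /ltnW le_k'.
pose f (x : G) := widen_ord le_k' (enum_rank x).
have f_inj : injective f.
  by move=> x y /(congr1 val) /= /val_inj /enum_rank_inj.
exists f; split=> [x y xy /f_inj eq_xy | i j].
  by rewrite eq_xy edge_irr in xy.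
apply: leq_trans (leq_addl _ _); apply: leq_trans r_gt0.
apply/card_le1_eqP => x y; rewrite !inE => /eqP fx /eqP fy.
by apply: f_inj; rewrite fx fy.
Qed.

Lemma equitable_thresholdP (r : nat) :
  0 < r -> is_equitable_threshold r (equitable_threshold r).
Proof.
move=> r_gt0.
have ex_k : exists k, boolp.asbool (colorable_from r k).
  by exists #|G|.+1; apply/boolp.asboolP; apply: colorable_from_card.
case: (ex_minnP ex_k) => k /boolp.asboolP k_ok k_min.
apply: (@classical_sets.xgetPex _ 0 (is_equitable_threshold r)).
by exists k; split=> // l l_ok; apply: k_min; apply/boolp.asboolP.
Qed.

Lemma is_equitable_threshold_uniq (r k l : nat) :
  is_equitable_threshold r k -> is_equitable_threshold r l -> k = l.
Proof.
move=> [k_ok k_min] [l_ok l_min]; apply/eqP.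
by rewrite eqn_leq k_min // l_min.
Qed.

End Coloring.

Section Kronecker.
Variables G H : sgraph.

Definition kronecker_edge : rel (G * H) :=
  fun u v => edge u.1 v.1 && edge u.2 v.2.

Fact kronecker_sym : symmetric kronecker_edge.
Proof. by move=> u v; rewrite /kronecker_edge !(@edge_sym _ u.1, @edge_sym _ u.2). Qed.

Fact kronecker_irr : irreflexive kronecker_edge.
Proof. by move=> u; rewrite /kronecker_edge edge_irr. Qed.

Definition kronecker : sgraph := SGraph kronecker_sym kronecker_irr.
End Kronecker.

Section Complete.
Variables m n : nat.

Definition complete_edge : rel 'I_m := fun x y => x != y.

Fact complete_sym : symmetric complete_edge.
Proof. by move=> x y; rewrite /complete_edge eq_sym. Qed.

Fact complete_irr : irreflexive complete_edge.
Proof. by move=> x; rewrite /complete_edge eqxx. Qed.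

Definition complete_graph : sgraph := SGraph complete_sym complete_irr.

(* Vertex (i, a) is the a-th vertex of the i-th part. *)
Definition multipartite_edge : rel ('I_m * 'I_n) := fun u v => u.1 != v.1.

Fact multipartite_sym : symmetric multipartite_edge.
Proof. by move=> u v; rewrite /multipartite_edge eq_sym. Qed.

Fact multipartite_irr : irreflexive multipartite_edge.
Proof. by move=> u; rewrite /multipartite_edge eqxx. Qed.

Definition complete_multipartite : sgraph :=
  SGraph multipartite_sym multipartite_irr.
End Complete.

(* Main.v *)
Require Import Defs.
From mathcomp Require Import all_boot all_order all_algebra.
From mathcomp Require Import zify.

(** A color class of [K_m x K_n] lies in a row or in a column.  If an equitable
    coloring has a class meeting two rows, that class has at most [m] elements,
    so every class has at most [m + r] and [m * n <= k * (m + r)]; otherwise the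
    coloring is already proper for [K_{m(n)}].  On the other side, [K_{m(n)}] has
    a coloring with all class sizes in [[s, s + r]] as soon as
    [m * ceil (n / (s + r)) <= k <= m * floor (n / s)].  The bound on [n] makes
    these ranges overlap for consecutive [s < m + r], so together they contain
    every [k >= m * n / (m + r)]. *)

Lemma card_residue_ge (n d b s : nat) :
  b < d -> s * d <= n -> s <= #|[set a : 'I_n | a %% d == b]|.
Proof.
move=> bd sdn.
have lt_n (j : 'I_s) : b + j * d < n by have := ltn_ord j; nia.
pose h (j : 'I_s) := Ordinal (lt_n j).
have h_inj : injective h.
  by move=> i j /(congr1 val) /= e; apply: val_inj => /=; nia.
rewrite -[X in X <= _]card_ord -(card_imset _ h_inj).
apply: subset_leq_card; apply/subsetP => _ /imsetP[j _ ->].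
by rewrite inE /= addnC modnMDl modn_small.
Qed.

Lemma card_residue_le (n d b t : nat) :
  n <= t * d -> #|[set a : 'I_n | a %% d == b]| <= t.
Proof.
move=> ntd.
have lt_t (a : 'I_n) : a %/ d < t.
  (* For [d = 0] the hypothesis forces [n = 0], so no [a] exists. *)
  case: d ntd => [|d] ntd; first by have := ltn_ord a; lia.
  by rewrite ltn_divLR //; exact: leq_trans (ltn_ord a) ntd.
pose h (a : 'I_n) := Ordinal (lt_t a).
rewrite -[X in _ <= X]card_ord -(@card_in_imset _ _ h); first exact: max_card.
move=> x y; rewrite !inE => /eqP xb /eqP yb /(congr1 val) /= e.
by apply: val_inj; rewrite /= (divn_eq x d) (divn_eq y d) e xb yb.
Qed.

(** Color [i + b * m] goes to the vertices of part [i] whose index is [b] modulo [d i]. Since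
    [q <= d i] and [s * d i <= n], each class has between [s] and [s + r] elements. *)
Lemma multipartite_colorable (m n r k s q : nat) :
  0 < m -> 0 < n -> n <= q * (s + r) -> m * q <= k ->
  (0 < s -> k <= m * (n %/ s)) ->
  equitably_colorable (complete_multipartite m n) r k.
Proof.
move=> m0 n0 nq mqk kms.
(* The number of colors [c < k] congruent to [i] modulo [m]; these are the
   colors spent on part [i]. *)
pose d (i : nat) := (k + (m.-1 - i)) %/ m.
have d_ge (i : nat) : q <= d i by rewrite /d leq_divRL // mulnC; lia.
have d_gt0 i : 0 < d i by have := d_ge i; nia.
have d_up i : n <= (s + r) * d i by have := d_ge i; nia.
have d_lo i : s * d i <= n.
  case: (posnP s) => [-> //|s0].
  apply: (@leq_trans (s * (n %/ s))); last by rewrite mulnC leq_trunc_div.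
  (* The term added to [k] in [d i] is below [m], so [k <= m * (n %/ s)] still gives
     [d i < (n %/ s).+1]. *)
  rewrite leq_mul2l -ltnS /d ltn_divLR //; apply/orP; right.
  by have := kms s0; nia.
have d_col i b : i < m -> b < d i -> i + b * m < k.
  move=> im bd; have := leq_trunc_div (k + (m.-1 - i)) m.
  by rewrite -/(d i); nia.
have d_of (c i b : nat) : c < k -> c = i + b * m -> i < m -> b < d i.
  move=> ck e im; rewrite /d leq_divRL //; nia.
have f_lt (u : 'I_m * 'I_n) : u.1 + (u.2 %% d u.1) * m < k.
  by apply: d_col => //; rewrite ltn_mod.
pose f (u : complete_multipartite m n) : 'I_k := Ordinal (f_lt u).
have fE u c : (f u == c) = (val u.1 == c %% m) && (u.2 %% d u.1 == c %/ m).
  apply/eqP/andP => [<- /=|[/eqP u1 /eqP u2]].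
    by rewrite addnC modnMDl divnMDl // modn_small // divn_small // addn0.
  by apply: val_inj; rewrite /= u2 u1 addnC -divn_eq.
have size c : s <= #|color_class f c| <= s + r.
  have cm : c %% m < m by rewrite ltn_mod.
  pose i := Ordinal cm.
  have bd : c %/ m < d i.
    by apply: (d_of c) => //=; rewrite addnC -divn_eq.
  have -> : color_class f c =
      [set (i, a) | a in [set a : 'I_n | a %% d i == c %/ m]].
    apply/setP => -[j a]; rewrite inE fE /=; apply/andP/imsetP.
      move=> [/eqP ji ja]; have {}ji : j = i by apply: val_inj.
      by rewrite ji in ja *; exists a; rewrite ?inE.
    by move=> [a']; rewrite inE => a'b [-> ->]; rewrite /= eqxx.
  rewrite card_imset; last by move=> x y [].
  by rewrite card_residue_ge //= card_residue_le.
exists f; split=> [x y xy fxy|i j].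
  have := fE x (f x); have := fE y (f x); rewrite {1}fxy !eqxx.
  move=> /esym/andP[/eqP y1 _] /esym/andP[/eqP x1 _].
  by case/negP: xy; apply/eqP/val_inj; rewrite /= x1 y1.
by have /andP[_ /leq_trans] := size i; apply; rewrite leq_add2r; case/andP: (size j).
Qed.

(* The real interval from [n / (s + r)] to [n / (s + 1)] has length at least 1,
   hence contains an integer. *)
Lemma leq_divS_mul (n r s : nat) :
  0 < r -> s.+1 * (s + r) <= n * (r - 1) -> n <= (s + r) * (n %/ s.+1).
Proof.
case: r => // t _; rewrite subSS subn0 addnS => h.
have : n < (n %/ s.+1).+1 * s.+1 by rewrite -ltn_divLR.
set q := n %/ s.+1 => nq.
(* With [r = t.+1] and [n <= q * s.+1 + s], this yields the goal. If instead [q * t < s], then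
   [n * t <= s * (s + t.+1)], against [h]. *)
have st : s <= q * t.
  rewrite leqNgt; apply/negP => qt.
  have nt : n * t <= (q * s.+1 + s) * t by rewrite leq_mul2r; lia.
  have qts : q * t * s.+1 <= s * s.+1 by rewrite leq_mul2r; lia.
  lia.
lia.
Qed.

Lemma multipartite_colorable_large (m n r k : nat) :
  0 < m -> 0 < n -> 1 < r -> (m + r) * (m + 2 * r - 1) <= n * (r - 1) ->
  m * n <= k * (m + r) ->
  equitably_colorable (complete_multipartite m n) r k.
Proof.
move=> m0 n0 r1 hn hk.
(* Take the largest [s] whose upper bound on [k] holds; failure at [s.+1] then provides the lower
   bound [m * q <= k]. *)
pose P s := (s < m + r) && ((s == 0) || (k <= m * (n %/ s))).
have exP : exists s, P s by exists 0; rewrite /P; lia.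
have leP s : P s -> s <= m + r by case/andP => /ltnW.
case: (ex_maxnP exP leP) => s /andP[s_lt s_ok] s_max.
pose q := n %/ s.+1.
have qn : q * s.+1 <= n by exact: leq_trunc_div.
apply: (@multipartite_colorable m n r k s q) => //.
- rewrite mulnC; apply: leq_divS_mul; first exact: ltnW.
  by apply: leq_trans hn; apply: leq_mul; lia.
- case: (ltnP s.+1 (m + r)) => s1.
    have := s_max s.+1; rewrite /P s1 /= -/q.
    by case: (leqP k (m * q)) => [_ /(_ isT)|/ltnW //]; rewrite ltnn.
  (* At the end of the range maximality says nothing, and the bound [hk] on [k] takes over. *)
  have e : s.+1 = m + r by lia.
  have mr : 0 < m + r by rewrite addn_gt0 m0.
  rewrite -(leq_pmul2r mr) -mulnA; apply: leq_trans hk.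
  by rewrite leq_mul2l -e qn orbT.
- by move=> s0; move: s_ok; rewrite eqn0Ngt s0.
Qed.

(** The Kronecker product is a spanning subgraph of the multipartite graph. *)
Lemma kronecker_of_multipartite (m n r k : nat) :
  equitably_colorable (complete_multipartite m n) r k ->
  equitably_colorable (kronecker (complete_graph m) (complete_graph n)) r k.
Proof.
by move=> [f [fc fe]]; exists f; split=> // x y /andP[xy _]; apply: fc.
Qed.

(** Vertices of one color share a row or a column. So [x] and [y] share a column, and a third vertex
    outside it would share its row with both, which is impossible. *)
Lemma kronecker_class_in_column (m n k : nat)
    (f : kronecker (complete_graph m) (complete_graph n) -> 'I_k) x y :
  coloring f -> f x = f y -> x.1 != y.1 ->
  #|color_class f (f x)| <= m.
Proof.
move=> fc fxy x1y1.
have share u v : f u = f v -> u.1 = v.1 \/ u.2 = v.2.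
  move=> fuv; case: (eqVneq u.1 v.1) => [|n1]; first by left.
  case: (eqVneq u.2 v.2) => [|n2]; first by right.
  by case: (fc u v) => //; apply/andP.
have xy2 : x.2 = y.2 by case: (share _ _ fxy) => // e; rewrite e eqxx in x1y1.
have col z : z \in color_class f (f x) -> z.2 = x.2.
  rewrite inE => /eqP fz; case: (share _ _ fz) => // zx.
  case: (share z y); rewrite ?fz // ?xy2 // => zy.
  by rewrite -zx zy eqxx in x1y1.
rewrite -[X in _ <= X]card_ord.
rewrite -(@card_in_imset _ _ (fun z : 'I_m * 'I_n => z.1)); first exact: max_card.
move=> [u1 u2] [v1 v2] /col /= u2x /col /= v2x /= ->.
by rewrite u2x v2x.
Qed.

Lemma multipartite_of_kronecker (m n r k : nat) :
  0 < m -> 0 < n -> 1 < r -> (m + r) * (m + 2 * r - 1) <= n * (r - 1) ->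
  equitably_colorable (kronecker (complete_graph m) (complete_graph n)) r k ->
  equitably_colorable (complete_multipartite m n) r k.
Proof.
move=> m0 n0 r1 hn [f [fc fe]].
case: (boolP [forall x : 'I_m * 'I_n, forall y : 'I_m * 'I_n,
         (x.1 != y.1) ==> (f x != f y)]) => [/forallP rows|].
  exists f; split=> // x y xy; apply/eqP.
  by have /forallP/(_ y)/implyP := rows x; apply.
rewrite negb_forall => /existsP[x]; rewrite negb_forall => /existsP[y].
rewrite negb_imply negbK => /andP[xy /eqP fxy].
apply: multipartite_colorable_large => //.
have small i : #|color_class f i| <= m + r.
  apply: leq_trans (fe i (f x)) _; rewrite leq_add2r.
  exact: kronecker_class_in_column fc fxy xy.
have <- : #|{: 'I_m * 'I_n}| = m * n by rewrite card_prod !card_ord.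
rewrite -sum1_card (partition_big f predT) //=.
apply: (@leq_trans (\sum_(i < k) (m + r))); last by rewrite sum_nat_const card_ord.
apply: leq_sum => i _; rewrite sum1dep_card; exact: small.
Qed.

(** [equitable_threshold] is a chosen value, so equality goes through uniqueness of its
    specification. *)
Lemma equitable_threshold_eq (G H : sgraph) (r : nat) :
  0 < r ->
  (forall k, 0 < k -> equitably_colorable G r k <-> equitably_colorable H r k) ->
  equitable_threshold G r = equitable_threshold H r.
Proof.
move=> r0 GH.
have from k : colorable_from G r k <-> colorable_from H r k.
  by split=> -[k0 kG]; split=> // k' kk'; apply/GH; auto; apply: leq_trans kk'.
apply: (@is_equitable_threshold_uniq H r); last exact: equitable_thresholdP.
have [ok min] := @equitable_thresholdP G r r0.
by split=> [|l /from /min //]; apply/from.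
Qed.

Lemma size_bound_nat (m n r : nat) : 1 < r ->
  ((1 / (r%:R - 1)) * (m%:R + r%:R) * (m%:R + 2 * r%:R - 1) <= n%:R :> rat)%R ->
  (m + r) * (m + 2 * r - 1) <= n * (r - 1).
Proof.
move=> r1.
have r_gt0 : (0 < (r - 1)%:R :> rat)%R by rewrite Num.Theory.ltr0n subn_gt0.
(* Neither truncated subtraction cuts off, because [1 < r]. *)
have -> : (r%:R - 1 = (r - 1)%:R :> rat)%R by rewrite GRing.natrB // ltnW.
have -> : (m%:R + 2 * r%:R - 1 = (m + 2 * r - 1)%:R :> rat)%R.
  have mr : 0 < m + 2 * r by lia.
  by rewrite (GRing.natrB _ mr) GRing.natrD GRing.natrM.
rewrite -GRing.natrD GRing.mul1r -GRing.mulrA GRing.mulrC.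
by rewrite Num.Theory.ler_pdivrMr // -!GRing.natrM Num.Theory.ler_nat.
Qed.

Theorem theorem7 (m n r : nat)
    (hm : (2 <= m)%N) (hmn : (m <= n)%N) (hr : (2 <= r)%N)
    (hn : ((1 / (r%:R - 1)) * (m%:R + r%:R) * (m%:R + 2 * r%:R - 1)
             <= n%:R :> rat)%R) :
  equitable_threshold (kronecker (complete_graph m) (complete_graph n)) r
    = equitable_threshold (complete_multipartite m n) r
  /\ (forall k : nat, (0 < k)%N ->
        equitably_colorable (kronecker (complete_graph m) (complete_graph n)) r k
        <-> equitably_colorable (complete_multipartite m n) r k).
Proof.
have m0 : 0 < m by apply: ltnW.
have n0 : 0 < n by apply: leq_trans hmn.
have iff k : 0 < k ->
    equitably_colorable (kronecker (complete_graph m) (complete_graph n)) r k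
    <-> equitably_colorable (complete_multipartite m n) r k.
  move=> _; split; last exact: kronecker_of_multipartite.
  by apply: multipartite_of_kronecker => //; apply: size_bound_nat.
by split=> //; apply: equitable_threshold_eq => //; apply: ltnW.
Qed.
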